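(* Let $(d_n)_{n\ge1}$ be a fixed sequence of integers $d_n\ge2$ and let $a_0=\sum_{n=1}^{\infty}\frac{d_{2n}-1}{d_1d_2\cdots d_{2n}}$. Each number $x\in[a_0-1;a_0]$ can be represented by an alternating Cantor series, i.e. there exist digits $\varepsilon_n\in\{0,1,\dots,d_n-1\}$, $n\ge 1$, such that $$x=\sum_{n=1}^{\infty}\frac{(-1)^n\varepsilon_n}{d_1d_2\cdots d_n}.$$ *)

(* Defs.v *)
From HB Require Import structures.
From mathcomp Require Import all_boot all_order all_algebra.
From mathcomp Require Import all_classical all_reals all_analysis.
Set Implicit Arguments.
Unset Strict Implicit.
Unset Printing Implicit Defensive.
Import Order.TTheory GRing.Theory Num.Theory.
Import numFieldNormedType.Exports.
Local Open Scope classical_set_scope.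
Local Open Scope ring_scope.

(* Sequences (d_n), (eps_n) with n >= 1 are functions on nat whose value at 0
   is never used: the product is d_1 d_2 ... d_n. *)
Definition cantor_den (d : nat -> nat) (n : nat) : nat :=
  (\prod_(1 <= i < n.+1) d i)%N.

(* When all d_n >= 2 the partial sums are nondecreasing and bounded by 1, so
   that the limit below is a genuine one. *)
Definition cantor_a0 (R : realType) (d : nat -> nat) : R :=
  limn (fun N : nat =>
    \sum_(1 <= n < N.+1) ((d (2 * n)%N)%:R - 1) / (cantor_den d (2 * n))%:R : R).

Definition alt_cantor_represents (R : realType) (d eps : nat -> nat) (x : R)
    : Prop :=
  (forall n : nat, (1 <= n)%N -> (eps n <= d n - 1)%N) /\
  (fun N : nat =>
     \sum_(1 <= n < N.+1) (-1) ^+ n * (eps n)%:R / (cantor_den d n)%:R : R)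
    @ \oo --> x.

(* Main.v *)
Require Import Defs.
From mathcomp Require Import all_boot all_order all_algebra.
From mathcomp Require Import all_classical all_reals all_analysis.
From mathcomp Require Import zify ring lra.
Import Order.TTheory GRing.Theory Num.Theory.
Import numFieldNormedType.Exports.
Local Open Scope classical_set_scope.
Local Open Scope ring_scope.

(** Write P_n = d_1 ... d_n and y = x + 1 - a_0, so that y lies in [0, 1].  The
    greedy algorithm gives y an ordinary Cantor expansion with digits delta_n:
    the remainders r_0 = y, r_n = d_n r_(n-1) - delta_n stay in [0, 1], and
    y = sum_(n <= N) delta_n / P_n + r_N / P_N ([cantor_expansion]).

    Complementing the digits of odd index, eps_n = d_n - 1 - delta_n for n odd
    and eps_n = delta_n for n even, turns it into an alternating expansion:
    (-1)^n eps_n / P_n is delta_n / P_n minus, for n odd, (d_n - 1) / P_n.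
    As the sum of (d_n - 1) / P_n over all n <= N telescopes to 1 - 1 / P_N,
    and its part over even n is a partial sum of a_0, the N-th partial sum of
    the alternating series is y - 1 + A_(N/2) + (1 - r_N) / P_N, where A_M is
    the M-th partial sum of a_0 ([alt_cantor_partial_sum]); it tends to
    y - 1 + a_0 = x. *)

(** The greedy digit in base [k] of a number of [0, 1]; the minimum with
    [k - 1] only matters at 1, whose digits are all maximal. *)
Definition greedy_digit {R : realType} (k : nat) (r : R) : nat :=
  minn (Num.truncn (k%:R * r)) (k - 1).

(** [greedy_rem d y n] is the remainder left after [n] digits of [y], scaled
    by d_1 ... d_n. *)
Fixpoint greedy_rem {R : realType} (d : nat -> nat) (y : R) (n : nat) : R :=
  if n is m.+1 then
    (d n)%:R * greedy_rem d y m - (greedy_digit (d n) (greedy_rem d y m))%:R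
  else y.

(** The n-th digit of the greedy Cantor expansion of [y], for n >= 1. *)
Definition cantor_digit {R : realType} (d : nat -> nat) (y : R) (n : nat) :=
  greedy_digit (d n) (greedy_rem d y n.-1).

(** The greedy digits with those of odd index n complemented to d_n - 1. *)
Definition alt_digit {R : realType} (d : nat -> nat) (y : R) (n : nat) : nat :=
  if odd n then (d n - 1 - cantor_digit d y n)%N else cantor_digit d y n.

(** The N-th partial sum of the series defining a_0. *)
Definition a0_partial (R : realType) (d : nat -> nat) (N : nat) : R :=
  \sum_(1 <= n < N.+1) ((d (2 * n)%N)%:R - 1) / (cantor_den d (2 * n))%:R.

Lemma greedy_digit_rem_itv (R : realType) (k : nat) (r : R) :
  (0 < k)%N -> 0 <= r <= 1 -> 0 <= k%:R * r - (greedy_digit k r)%:R <= 1.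
Proof.
move=> k0 /andP[r0 r1]; rewrite /greedy_digit.
have kr0 : 0 <= k%:R * r by rewrite mulr_ge0.
have krk : k%:R * r <= k%:R by rewrite ler_piMr.
have /andP[tle tlt] := truncn_itv kr0.
have [tk|kt] := leqP (Num.truncn (k%:R * r)) (k - 1).
  by move: tlt; rewrite -natr1 => tlt; apply/andP; split; lra.
have : (k - 1)%:R <= (Num.truncn (k%:R * r))%:R :> R by rewrite ler_nat ltnW.
by rewrite natrB // => kt'; apply/andP; split; lra.
Qed.

Section CantorSeries.
Variables (R : realType) (d : nat -> nat).
Hypothesis hd : forall n : nat, (1 <= n)%N -> (2 <= d n)%N.

Local Notation P n := ((cantor_den d n)%:R : R).

Lemma cantor_den0 : cantor_den d 0 = 1%N.
Proof. by rewrite /cantor_den big_geq. Qed.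

Lemma cantor_denS n : cantor_den d n.+1 = (cantor_den d n * d n.+1)%N.
Proof. by rewrite /cantor_den big_nat_recr. Qed.

Lemma cantor_den_gt n : (n < cantor_den d n)%N.
Proof.
elim: n => [|n IHn]; first by rewrite cantor_den0.
by rewrite cantor_denS; have := hd n.+1 isT; nia.
Qed.

Lemma cantor_den_neq0 n : P n != 0.
Proof. by rewrite pnatr_eq0 -lt0n; exact: leq_ltn_trans (cantor_den_gt n). Qed.

Lemma cantor_base_neq0 n : (d n.+1)%:R != 0 :> R.
Proof. by rewrite pnatr_eq0 -lt0n; exact: ltnW (hd n.+1 isT). Qed.

Lemma max_digit_ge0 n : (0 < n)%N -> 0 <= ((d n)%:R - 1) / P n.
Proof. by move=> n0; rewrite divr_ge0 // subr_ge0 ler1n ltnW // hd. Qed.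

Lemma sum_max_digits N :
  \sum_(1 <= n < N.+1) ((d n)%:R - 1) / P n = 1 - (P N)^-1.
Proof.
elim: N => [|N IHN]; first by rewrite big_geq // cantor_den0 invr1 subrr.
rewrite big_nat_recr //= IHN cantor_denS natrM.
by field; rewrite cantor_den_neq0 cantor_base_neq0.
Qed.

Lemma a0_partial_half N :
  a0_partial R d N./2
  = \sum_(1 <= n < N.+1 | ~~ odd n) ((d n)%:R - 1) / P n.
Proof.
elim: N => [|N IHN]; first by rewrite /a0_partial !big_geq.
rewrite big_mkcond big_nat_recr //= -big_mkcond -IHN /= uphalf_half.
rewrite negbK; case: ifP => oN; last by rewrite add0n addr0.
rewrite add1n /a0_partial big_nat_recr //=.
by have -> : (2 * N./2.+1 = N.+1)%N by lia.
Qed.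

Lemma a0_partial_cvg : a0_partial R d @ \oo --> cantor_a0 R d.
Proof.
apply: nondecreasing_is_cvgn.
  apply/nondecreasing_seqP => n.
  rewrite /a0_partial [leRHS]big_nat_recr //= lerDl.
  exact: max_digit_ge0.
exists 1 => _ [n _ <-].
(* The partial sum is the even-index part of a telescoping sum below 1. *)
rewrite -[n]doubleK a0_partial_half big_mkcond.
apply: (@le_trans _ _ (\sum_(1 <= k < n.*2.+1) ((d k)%:R - 1) / P k)).
  rewrite big_nat_cond [leRHS]big_nat_cond.
  apply: ler_sum => k /andP[/andP[k0 _] _].
  by case: ifP => // _; exact: max_digit_ge0.
by rewrite sum_max_digits gerBl invr_ge0.
Qed.

Lemma a0_partial_half_cvg :
  (fun N => a0_partial R d N./2) @ \oo --> cantor_a0 R d.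
Proof.
apply: (cvg_comp (fun N => N./2) (a0_partial R d) _ a0_partial_cvg).
apply/cvgnyPge => A; near=> N.
have : (A.*2 <= N)%N by near: N; exact: nbhs_infty_ge.
by lia.
Unshelve. all: by end_near. Qed.

Variable y : R.
Hypothesis y01 : 0 <= y <= 1.

Lemma greedy_rem_itv n : 0 <= greedy_rem d y n <= 1.
Proof.
elim: n => [//|n IHn] /=; apply: greedy_digit_rem_itv => //.
exact: ltnW (hd _ _).
Qed.

Lemma cantor_expansion N :
  \sum_(1 <= n < N.+1) (cantor_digit d y n)%:R / P n
  = y - greedy_rem d y N / P N.
Proof.
elim: N => [|N IHN]; first by rewrite big_geq // cantor_den0 divr1 subrr.
rewrite big_nat_recr //= IHN cantor_denS natrM /cantor_digit /=.
by field; rewrite cantor_den_neq0 cantor_base_neq0.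
Qed.

Lemma cantor_digit_le n : (cantor_digit d y n <= d n - 1)%N.
Proof. exact: geq_minr. Qed.

Lemma alt_digit_le n : (alt_digit d y n <= d n - 1)%N.
Proof.
by rewrite /alt_digit; case: ifP => _; rewrite ?leq_subr ?cantor_digit_le.
Qed.

Lemma alt_cantor_partial_sum N :
  \sum_(1 <= n < N.+1) (-1) ^+ n * (alt_digit d y n)%:R / P n
  = y - 1 + a0_partial R d N./2 + (1 - greedy_rem d y N) / P N.
Proof.
have -> : \sum_(1 <= n < N.+1) (-1) ^+ n * (alt_digit d y n)%:R / P n
    = \sum_(1 <= n < N.+1) (cantor_digit d y n)%:R / P n
      - \sum_(1 <= n < N.+1) ((d n)%:R - 1) / P n
      + \sum_(1 <= n < N.+1 | ~~ odd n) ((d n)%:R - 1) / P n.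
  rewrite [X in _ + X]big_mkcond -sumrB -big_split /=.
  apply: eq_big_nat => n /andP[n0 _].
  rewrite /alt_digit -signr_odd; case: ifP => _ /=; last by rewrite expr0; ring.
  rewrite natrB ?cantor_digit_le // natrB ?expr1; last exact: ltnW (hd n n0).
  by ring.
rewrite cantor_expansion sum_max_digits -a0_partial_half.
by field; exact: cantor_den_neq0.
Qed.

Lemma alt_cantor_tail_cvg0 :
  (fun N => (1 - greedy_rem d y N) / P N) @ \oo --> (0 : R).
Proof.
apply: (@squeeze_cvgr _ _ _ _ (fun=> 0) (@harmonic R)).
- near=> N; have /andP[r0 r1] := greedy_rem_itv N.
  rewrite divr_ge0 ?subr_ge0 //= ler_pdivrMr; last first.
    by rewrite lt0r cantor_den_neq0 /=.
  apply: (@le_trans _ _ 1); first by rewrite gerBl.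
  by rewrite mulrC ler_pdivlMr ?ltr0Sn // mul1r ler_nat cantor_den_gt.
- exact: cvg_cst.
- exact: cvg_harmonic.
Unshelve. all: by end_near. Qed.

Lemma alt_digit_represents :
  alt_cantor_represents d (alt_digit d y) (y - 1 + cantor_a0 R d).
Proof.
split=> [n _|]; first exact: alt_digit_le.
under eq_fun do rewrite alt_cantor_partial_sum.
rewrite -[y - 1 + cantor_a0 R d]addr0.
apply: cvgD; last exact: alt_cantor_tail_cvg0.
by apply: cvgD; [exact: cvg_cst | exact: a0_partial_half_cvg].
Qed.

End CantorSeries.

Theorem lemma3 (R : realType) (d : nat -> nat)
    (hd : forall n : nat, (1 <= n)%N -> (2 <= d n)%N)
    (x : R) (hx : cantor_a0 R d - 1 <= x <= cantor_a0 R d) :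
  exists eps : nat -> nat, alt_cantor_represents d eps x.
Proof.
have y01 : 0 <= x + 1 - cantor_a0 R d <= 1.
  by move: hx => /andP[x0 x1]; apply/andP; split; lra.
exists (alt_digit d (x + 1 - cantor_a0 R d)).
have := alt_digit_represents R d hd _ y01.
by congr (alt_cantor_represents _ _ _); ring.
Qed.
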